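(* For any $X,Y\in\mathrm{Sym}^+(p)$, the scaling–rotation distance $d_{\mathcal{SR}}$ is (i) invariant under matrix inversion, i.e., $d_{\mathcal{SR}}(X,Y)=d_{\mathcal{SR}}(X^{-1},Y^{-1})$; (ii) invariant under simultaneous uniform scaling and conjugation by a rotation matrix, i.e., $d_{\mathcal{SR}}(X,Y)=d_{\mathcal{SR}}(sRXR',sRYR')$ for any $s>0$, $R\in\mathrm{SO}(p)$; (iii) a semi-metric on $\mathrm{Sym}^+(p)$, that is, $d_{\mathcal{SR}}(X,Y)\ge0$, $d_{\mathcal{SR}}(X,Y)=0$ if and only if $X=Y$, and $d_{\mathcal{SR}}(X,Y)=d_{\mathcal{SR}}(Y,X)$.
   Context: A prime denotes transpose. $\mathrm{Sym}^+(p)$ is the set of real symmetric positive-definite $p\times p$ matrices; $\mathrm{SO}(p)$ the set of rotation matrices; $\mathrm{Diag}^+(p)$ the set of diagonal matrices with positive diagonal entries (in no particular order). For $X\in\mathrm{Sym}^+(p)$, $\mathcal{E}_X=\{(U,D)\in\mathrm{SO}(p)\times\mathrm{Diag}^+(p):X=UDU'\}$. Fix $k>0$. On $\mathrm{SO}(p)\times\mathrm{Diag}^+(p)$ the geodesic distance $d$ is $$d^2\big((U,D),(V,\Lambda)\big)=\frac{k}{2}\|\log(VU')\|_F^2+\|\log(\Lambda D^{-1})\|_F^2,$$ where $\|\cdot\|_F$ is the Frobenius norm; for $R\in\mathrm{SO}(p)$, $\log(R)$ is an antisymmetric $A$ with $\exp(A)=R$ of smallest Frobenius norm (any choice if not unique),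 and on $\mathrm{Diag}^+(p)$ $\log$ is the entrywise logarithm of the diagonal. The scaling–rotation distance is $d_{\mathcal{SR}}(X,Y)=\inf\{d((U,D),(V,\Lambda)):(U,D)\in\mathcal{E}_X,\ (V,\Lambda)\in\mathcal{E}_Y\}$. *)

(* Defs.v *)
From mathcomp Require Import all_boot all_order all_algebra.
From mathcomp Require Import all_classical all_reals all_analysis.

Set Implicit Arguments.
Unset Strict Implicit.
Unset Printing Implicit Defensive.

Import Order.TTheory GRing.Theory Num.Theory.
Import numFieldNormedType.Exports.
Local Open Scope classical_set_scope.
Local Open Scope ring_scope.

Section Defs.
Variables (R : realType) (p : nat).
Implicit Types (A B D Q X Y : 'M[R]_p).

Definition SymPos : set 'M[R]_p :=
  [set X | X^T = X /\
           forall v : 'cV[R]_p, v != 0 -> 0 < (v^T *m X *m v) ord0 ord0].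

Definition SO : set 'M[R]_p := [set Q | Q *m Q^T = 1%:M /\ \det Q = 1].

Definition DiagPos : set 'M[R]_p :=
  [set D | is_diag_mx D /\ forall i, 0 < D i i].

Definition frobenius A : R := Num.sqrt (\sum_i \sum_j A i j ^+ 2).

(* The limit is taken in the product topology of 'M[R]_p. *)
Definition mxexp A : 'M[R]_p :=
  limn (series (fun n => (n`!%:R)^-1 *: A ^+ n)).

Definition antisym : set 'M[R]_p := [set A | A^T = - A].

Definition is_rot_log Q : set 'M[R]_p :=
  [set A | [/\ antisym A, mxexp A = Q &
    forall B, antisym B -> mxexp B = Q -> frobenius A <= frobenius B]].

(* An arbitrary choice among the minimal logarithms; the default value 0 is
   only returned when Q has no minimal antisymmetric logarithm, which does not
   happen for Q in SO. *)
Definition rot_log Q : 'M[R]_p := xget 0 (is_rot_log Q).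

Definition diag_log D : 'M[R]_p := diag_mx (\row_i ln (D i i)).

Definition eigen_decomp X : set ('M[R]_p * 'M[R]_p) :=
  [set UD | [/\ SO UD.1, DiagPos UD.2 & X = UD.1 *m UD.2 *m UD.1^T]].

Definition geo_dist (k : R) (a b : 'M[R]_p * 'M[R]_p) : R :=
  Num.sqrt (k / 2 * frobenius (rot_log (b.1 *m a.1^T)) ^+ 2
            + frobenius (diag_log (b.2 *m invmx a.2)) ^+ 2).

Definition sr_dist (k : R) X Y : R :=
  inf [set geo_dist k a b | a in eigen_decomp X & b in eigen_decomp Y].

End Defs.

Arguments SymPos {R p}.
Arguments SO {R p}.
Arguments DiagPos {R p}.
Arguments antisym {R p}.

(* Main.v *)
Require Import Defs.
From mathcomp Require Import all_boot all_order all_algebra.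
From mathcomp Require Import all_classical all_reals all_analysis.
From mathcomp Require Import ring lra.

(* The distance [d] on pairs is invariant under (U, D) -> (U, D^-1) and under
   (U, D) -> (QU, sD), and these maps carry eigen-decompositions of X to those of
   X^-1 and of sQXQ'; hence the invariance of the infimum.  This uses that the
   norm of a minimal logarithm is unchanged by transposition and by conjugation.
   Such a logarithm exists on all of SO(p): exp is onto, and the antisymmetric
   logarithms of bounded norm form a compact set.

   Surjectivity of exp: diagonalize the symmetric part of Q as W diag(c) W'.  In
   that basis Q = diag(c) + K with K antisymmetric, commuting with diag(c), and
   K^2 = diag(c^2 - 1).  So K / sqrt(1 - c^2) is a complex structure where
   |c| < 1; since det Q = 1, the indices with c = -1 are even in number and also
   carry a complex structure.  Multiplying by arccos(c) gives the logarithm.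

   Separation: if d((U, D), (V, L)) is small, then VU' = exp(log(VU')) is close to
   1 and L is close to D with bounds depending only on the traces of X and Y, so
   all entries of X - Y are arbitrarily small. *)

Set Implicit Arguments.
Unset Strict Implicit.
Unset Printing Implicit Defensive.

Import Order.TTheory GRing.Theory Num.Theory.
Import numFieldNormedType.Exports.
Local Open Scope classical_set_scope.
Local Open Scope ring_scope.

(** * The matrix exponential *)

(** A basic neighbourhood of a matrix is a product of neighbourhoods of its finitely many entries,
    and filters are stable under finite intersections. *)
Lemma cvg_mx_coord (R : realType) (T : Type) (F : set_system T) m n
    (f : T -> 'M[R]_(m, n)) (M : 'M[R]_(m, n)) : Filter F ->
  (forall i j, (fun x => f x i j) @ F --> M i j) -> f @ F --> M.
Proof.
move=> FF cf S [P nP PS].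
have : \forall x \near F, forall ij : 'I_m * 'I_n, P ij.1 ij.2 (f x ij.1 ij.2).
  apply: filter_forall => -[i j] /=.
  exact: cf (P i j) (nP i j).
by apply: filterS => x Px; apply: PS => i j; exact: (Px (i, j)).
Qed.

Lemma mxpow_entry_le (R : realType) p (A : 'M[R]_p) (a : R) :
  (forall i j, `|A i j| <= a) ->
  forall n i j, `|(A ^+ n) i j| <= (p%:R * a) ^+ n.
Proof.
move=> Aa; elim=> [|n IH] i j.
  by rewrite !expr0 mxE; case: eqP; rewrite /= ?normr1 ?normr0 ?ler01.
rewrite !exprS -mulmxE mxE; apply: le_trans (ler_norm_sum _ _ _) _.
apply: (@le_trans _ _ (\sum_(k < p) a * (p%:R * a) ^+ n)).
  by apply: ler_sum => k _; rewrite normrM ler_pM.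
by rewrite sumr_const card_ord -[leLHS]mulr_natl mulrA.
Qed.

(** Induction on [A^(n+1) - B^(n+1) = A (A^n - B^n) + (A - B) B^n]; the bound mimics the derivative
    [n x^(n-1)] at [x = p a]. At [n = 0] the factor [n] makes the truncated exponent harmless. *)
Lemma mxpow_entry_sub_le (R : realType) p (A B : 'M[R]_p) (a e : R) :
  (forall i j, `|A i j| <= a) -> (forall i j, `|B i j| <= a) ->
  (forall i j, `|A i j - B i j| <= e) ->
  forall n i j, `|(A ^+ n) i j - (B ^+ n) i j|
    <= (p%:R * e) * (n%:R * (p%:R * a) ^+ n.-1).
Proof.
move=> Aa Ba ABe; elim=> [|n IH] i j.
  by rewrite !expr0 subrr normr0 mul0r mulr0.
have a0 : 0 <= a by exact: le_trans (Aa i j).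
have e0 : 0 <= e by exact: le_trans (ABe i j).
rewrite !exprS -mulmxE !mxE -sumrB; apply: le_trans (ler_norm_sum _ _ _) _.
apply: (@le_trans _ _ (\sum_(k < p) (a * ((p%:R * e) * (n%:R * (p%:R * a) ^+ n.-1))
    + e * (p%:R * a) ^+ n))).
  apply: ler_sum => k _.
  rewrite (_ : _ - _ = A i k * ((A ^+ n) k j - (B ^+ n) k j)
                     + (A i k - B i k) * (B ^+ n) k j); last first.
    by rewrite mulrBr mulrBl addrA subrK.
  apply: le_trans (ler_normD _ _) _; rewrite !normrM.
  apply: lerD; apply: ler_pM => //.
  exact: mxpow_entry_le.
rewrite sumr_const card_ord -[leLHS]mulr_natl /= le_eqVlt; apply/orP; left; apply/eqP.
case: n {IH} => [|n] /=; first by rewrite !expr0; ring.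
rewrite exprS -[n.+2%:R]natr1; ring.
Qed.

(** Each entry series is dominated by the real exponential series at [p a]; entrywise convergence
    then identifies the matrix limit defining [mxexp]. *)
Lemma mxexp_coord_cvg (R : realType) p (A : 'M[R]_p) i j :
  series (fun n => (n`!%:R)^-1 * (A ^+ n) i j) @ \oo --> mxexp A i j.
Proof.
have cvA i' j' : cvgn (series (fun n => (n`!%:R)^-1 * (A ^+ n) i' j')).
  apply: normed_cvg; pose a : R := \sum_i \sum_j `|A i j|.
  apply: series_le_cvg (is_cvg_series_exp_coeff (p%:R * a)) => n.
    exact: normr_ge0.
    by rewrite exp_coeff_ge0 // mulr_ge0 //; do 2!apply: sumr_ge0 => ? _.
  rewrite /exp_coeff /= normrM ger0_norm ?invr_ge0 ?ler0n // mulrC.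
  apply: ler_wpM2r; first by rewrite invr_ge0.
  apply: mxpow_entry_le => k l.
  rewrite /a (bigD1 k) //= (bigD1 l) //= -addrA lerDl addr_ge0 //.
    by apply: sumr_ge0.
  by do 2!apply: sumr_ge0 => ? _.
pose M : 'M[R]_p :=
  \matrix_(i, j) limn (series (fun n => (n`!%:R)^-1 * (A ^+ n) i j)).
suff -> : mxexp A = M by rewrite mxE; exact: cvA.
rewrite /mxexp; apply: (@cvg_lim _ (@norm_hausdorff R _)) => //.
apply: cvg_mx_coord => k l; rewrite mxE.
rewrite (_ : (fun _ => _) = series (fun n => (n`!%:R)^-1 * (A ^+ n) k l)).
  exact: cvA.
apply/funext => n; rewrite /series /= summxE.
by apply: eq_bigr => q _; rewrite mxE.
Qed.

Arguments mxexp_coord_cvg {R p} A i j.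

Lemma mxexp_unique (R : realType) p (A E : 'M[R]_p) :
  (forall i j, series (fun n => (n`!%:R)^-1 * (A ^+ n) i j) @ \oo --> E i j) ->
  mxexp A = E.
Proof.
move=> cE; apply/matrixP => i j.
by apply: (cvg_unique (@Rhausdorff R)) (cE i j); exact: mxexp_coord_cvg.
Qed.

Lemma mxexp_entry_lipschitz (R : realType) p (A B : 'M[R]_p) (a e : R) :
  (forall i j, `|A i j| <= a) -> (forall i j, `|B i j| <= a) ->
  (forall i j, `|A i j - B i j| <= e) ->
  forall i j, `|mxexp A i j - mxexp B i j| <= (p%:R * e) * expR (p%:R * a).
Proof.
move=> Aa Ba ABe i j.
have a0 : 0 <= a by exact: le_trans (Aa i j).
have e0 : 0 <= e by exact: le_trans (ABe i j).
have cAB : (fun n => `|series (fun n => (n`!%:R)^-1 * (A ^+ n) i j) n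
    - series (fun n => (n`!%:R)^-1 * (B ^+ n) i j) n|) @ \oo
    --> `|mxexp A i j - mxexp B i j|.
  by apply: cvg_norm; apply: cvgB; exact: mxexp_coord_cvg.
rewrite -(cvg_lim (@Rhausdorff R) cAB).
apply: limr_le; first exact: cvgP cAB.
apply: nearW => n /=.
rewrite /series /= -sumrB; apply: le_trans (ler_norm_sum _ _ _) _.
apply: (@le_trans _ _ (p%:R * e * series (exp_coeff (p%:R * a)) n)).
  rewrite /series /= mulr_sumr.
  (* Since [n / n! = 1 / (n-1)!], the bounds form the exponential series shifted by one index: the
     term of index 0 on the left vanishes and the last term on the right is dropped. *)
  case: n => [|n]; first by rewrite !big_nil.
  rewrite big_nat_recl // [leRHS]big_nat_recr //=.
  rewrite !expr0 subrr normr0 add0r -[leLHS]addr0.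
  apply: lerD; last first.
    by apply: mulr_ge0; [exact: mulr_ge0 | apply: exp_coeff_ge0; exact: mulr_ge0].
  apply: ler_sum => k _.
  rewrite -mulrBr normrM ger0_norm ?invr_ge0 ?ler0n //.
  apply: le_trans (ler_wpM2l _ (mxpow_entry_sub_le Aa Ba ABe k.+1 i j)) _.
    by rewrite invr_ge0.
  rewrite mulrCA ler_wpM2l ?mulr_ge0 //= /exp_coeff /= factS natrM.
  by rewrite invfM mulrACA mulVf ?pnatr_eq0 // mul1r mulrC.
rewrite ler_wpM2l ?mulr_ge0 // /expR.
apply: nondecreasing_cvgn_le; last exact: is_cvg_series_exp_coeff.
apply/nondecreasing_seqP => m; rewrite /series /= big_nat_recr //= lerDl.
by rewrite exp_coeff_ge0 // mulr_ge0.
Qed.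

Lemma mxexp0 (R : realType) p : mxexp (0 : 'M[R]_p) = 1%:M.
Proof.
apply: mxexp_unique => i j; apply: cvg_near_cst.
exists 1%N => // -[//|n] _; rewrite /series /=.
rewrite big_nat_recl // big1 => [|k _]; last by rewrite exprS mul0r mxE mulr0.
by rewrite addr0 fact0 invr1 mul1r expr0.
Qed.

Lemma trmx_exp (R : comNzRingType) p (A : 'M[R]_p) n : (A ^+ n)^T = A^T ^+ n.
Proof.
elim: n => [|n IH]; first by rewrite !expr0 trmx1.
by rewrite exprS exprSr -!mulmxE trmx_mul IH.
Qed.

Lemma mxexp_tr (R : realType) p (A : 'M[R]_p) : mxexp A^T = (mxexp A)^T.
Proof.
apply: mxexp_unique => i j; rewrite mxE.
rewrite (_ : (fun _ => _) = (fun n => (n`!%:R)^-1 * (A ^+ n) j i)).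
  exact: mxexp_coord_cvg.
by apply/funext => n; rewrite -trmx_exp mxE.
Qed.

(** Powers commute with conjugation, and an entry of a conjugate is a fixed finite linear
    combination of entries, which passes to the limit. *)
Lemma mxexp_conj (R : realType) p (W A : 'M[R]_p) : W^T *m W = 1%:M ->
  mxexp (W *m A *m W^T) = W *m mxexp A *m W^T.
Proof.
move=> W1; have W1' : W *m W^T = 1%:M by exact: mulmx1C.
have powW n : (W *m A *m W^T) ^+ n = W *m A ^+ n *m W^T.
  elim: n => [|n IH]; first by rewrite !expr0 mulmx1 W1'.
  by rewrite !exprS IH -!mulmxE !mulmxA -(mulmxA _ W^T W) W1 mulmx1.
apply: mxexp_unique => i j.
have E (M : 'M[R]_p) : (W *m M *m W^T) i j =
    \sum_k \sum_l W i l * W j k * M l k.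
  rewrite mxE; apply: eq_bigr => k _; rewrite !mxE mulr_suml.
  by apply: eq_bigr => l _; rewrite mulrAC.
rewrite E.
rewrite (_ : series _ = fun n => \sum_k \sum_l W i l * W j k *
    series (fun n => (n`!%:R)^-1 * (A ^+ n) l k) n).
  do 2!(apply: cvg_big => [|? _]; first exact: add_continuous).
  by apply: cvgMl_tmp; exact: mxexp_coord_cvg.
apply/funext => n; rewrite /series /=.
under eq_bigr do rewrite powW E mulr_sumr.
rewrite exchange_big /=; apply: eq_bigr => k _.
under eq_bigr do rewrite mulr_sumr.
rewrite exchange_big /=; apply: eq_bigr => l _.
by rewrite mulr_sumr; apply: eq_bigr => q _; rewrite mulrCA.
Qed.

(** * The spectral theorem for real symmetric matrices *)

(** This and the next two rules read off an entry without unfolding the matrix products inside, as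
    [mxE] would. *)
Lemma entryD (R : nmodType) m n (A B : 'M[R]_(m, n)) i j :
  (A + B) i j = A i j + B i j.
Proof. by rewrite mxE. Qed.

Lemma entryB (R : zmodType) m n (A B : 'M[R]_(m, n)) i j :
  (A - B) i j = A i j - B i j.
Proof. by rewrite !mxE. Qed.

Lemma entryZ (R : pzRingType) m n (c : R) (A : 'M[R]_(m, n)) i j :
  (c *: A) i j = c * A i j.
Proof. by rewrite mxE. Qed.

Lemma row_dotE (R : comNzRingType) n (v : 'rV[R]_n) :
  (v *m v^T) 0 0 = \sum_i v 0 i ^+ 2.
Proof. by rewrite mxE; apply: eq_bigr => i _; rewrite mxE expr2. Qed.

Lemma row_dot_ge0 (R : realDomainType) n (v : 'rV[R]_n) : 0 <= (v *m v^T) 0 0.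
Proof. by rewrite row_dotE sumr_ge0 // => i _; rewrite sqr_ge0. Qed.

Lemma row_dot_eq0 (R : realDomainType) n (v : 'rV[R]_n) :
  (v *m v^T) 0 0 = 0 -> v = 0.
Proof.
rewrite row_dotE => /eqP; rewrite psumr_eq0 => [/allP v0|i _]; last first.
  by rewrite sqr_ge0.
apply/rowP => i; have := v0 i (mem_index_enum i).
by rewrite sqrf_eq0 mxE => /eqP.
Qed.

(** With [u = v B], the form at [v - s u] equals [s (s q - 2 a)] where [a] is the squared length of
    [u]; for small positive [s] this is negative unless [a = 0]. *)
Lemma psd_isotropic_kernel (R : realFieldType) n (B : 'M[R]_n) (v : 'rV[R]_n) :
  B^T = B -> (forall w : 'rV[R]_n, 0 <= (w *m B *m w^T) 0 0) ->
  (v *m B *m v^T) 0 0 = 0 -> v *m B = 0.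
Proof.
move=> symB psdB v0; set u := v *m B; apply: row_dot_eq0.
have uT : B *m v^T = u^T by rewrite trmx_mul symB.
set a : R := (u *m u^T) 0 0; pose q : R := (u *m B *m u^T) 0 0.
have a0 : 0 <= a by exact: row_dot_ge0.
have q0 : 0 <= q by exact: psdB.
have ineq s : 0 <= s * (s * q - 2 * a).
  have := psdB (v - s *: u); rewrite [(v - _)^T]linearB /= [(s *: u)^T]linearZ /=.
  rewrite !mulmxBl !mulmxBr.
  rewrite -!scalemxAl -!scalemxAr -/u.
  rewrite -(mulmxA u B v^T) uT.
  rewrite !(entryB, entryZ).
  have -> : (u *m v^T) 0 0 = 0 by exact: v0.
  by rewrite -/a -/q; congr (_ <= _); ring.
(* Dividing by [q + 1] instead of [q] also covers [q = 0]. *)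
have := ineq (a / (q + 1)).
have q1 : 0 < q + 1 by lra.
have -> : a / (q + 1) * (a / (q + 1) * q - 2 * a)
    = - (a ^+ 2 * ((q + 2) / (q + 1) ^+ 2)).
  by field; rewrite gt_eqF.
rewrite oppr_ge0 pmulr_lle0; last by rewrite divr_gt0 ?exprn_gt0 //; lra.
by move=> a2; apply/eqP; rewrite -sqrf_eq0 eq_le a2 sqr_ge0.
Qed.

Lemma quadratic_formE (R : comNzRingType) n (A : 'M[R]_n) (v : 'rV[R]_n) :
  (v *m A *m v^T) 0 0 = \sum_i \sum_j v 0 j * A j i * v 0 i.
Proof.
rewrite mxE; apply: eq_bigr => i _; rewrite !mxE mulr_suml.
by apply: eq_bigr.
Qed.

Lemma quadratic_form_continuous (R : realType) n (A : 'M[R]_n) :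
  continuous (fun v : 'rV[R]_n => (v *m A *m v^T) 0 0).
Proof.
under eq_fun do rewrite quadratic_formE.
move=> v; have Fv : Filter (nbhs v) by exact: nbhs_filter.
apply: cvg_big => [|i _]; first exact: add_continuous.
apply: cvg_big => [|j _]; first exact: add_continuous.
apply: cvgM; last exact: coord_continuous.
by apply: cvgMr_tmp; exact: coord_continuous.
Qed.

Lemma rV_norm_le (R : realType) n (v : 'rV[R]_n) (c : R) : 0 <= c ->
  (forall i, `|v 0 i| <= c) -> `|v| <= c.
Proof.
move=> c0 vc; rewrite [leLHS]/Num.norm /= mx_normrE.
by apply: bigmax_le => // -[i j] _ /=; rewrite ord1.
Qed.

(* A maximizer of the quadratic form on the unit sphere is an eigenvector: with [l]
   the maximum, [l - A] is positive semidefinite and vanishes at the maximizer. *)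
Lemma symmetric_eigenvector (R : realType) n (A : 'M[R]_n.+1) : A^T = A ->
  exists (v : 'rV[R]_n.+1) (l : R), v *m v^T = 1%:M /\ v *m A = l *: v.
Proof.
move=> symA; pose S := [set v : 'rV[R]_n.+1 | (v *m v^T) 0 0 = 1].
have S0 : S !=set0.
  exists (delta_mx 0 0); rewrite /S /= row_dotE (bigD1 0) //= big1 => [|i i0].
    by rewrite mxE !eqxx expr1n addr0.
  by rewrite mxE (negbTE i0) andbF expr0n.
(* The topology comes from the sup norm, so boundedness of the Euclidean sphere is checked
   coordinate by coordinate. *)
have cS : compact S.
  apply: bounded_closed_compact.
    exists 1; split=> // x x1 v Sv /=; apply: rV_norm_le => [|i].
      by rewrite ltW // (lt_trans ltr01).
    apply: le_trans (ltW x1).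
    rewrite -(@ler_pXn2r _ 2) ?nnegrE // expr1n real_normK ?num_real //.
    by rewrite -Sv row_dotE (bigD1 i) //= lerDl sumr_ge0 // => j _; rewrite sqr_ge0.
  rewrite (_ : S = (fun v => (v *m 1%:M *m v^T) 0 0) @^-1` [set 1]).
    apply: (continuous_closedP _).1; first exact: quadratic_form_continuous.
    exact: closed_eq.
  by apply/seteqP; split=> v; rewrite /S /= mulmx1.
have := EVT_max_rV S0 cS (continuous_subspaceT (@quadratic_form_continuous R _ A)).
move=> [v /set_mem Sv vmax].
pose l := (v *m A *m v^T) 0 0.
have vv : v *m v^T = 1%:M by rewrite [LHS]mx11_scalar Sv.
exists v, l; split=> //; apply/eqP; rewrite -subr_eq0 -oppr_eq0 opprB; apply/eqP.
have -> : l *: v - v *m A = v *m (l%:M - A) by rewrite mulmxBr mul_mx_scalar.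
apply: psd_isotropic_kernel; first by rewrite linearB /= tr_scalar_mx symA.
  move=> w; rewrite mulmxBr mulmxBl mul_mx_scalar -scalemxAl entryB entryZ subr_ge0.
  set d := (w *m w^T) 0 0.
  have [d0|d0] := eqVneq d 0.
    by rewrite d0 mulr0 (row_dot_eq0 d0) !mul0mx mxE.
  have dp : 0 < d by rewrite lt_neqAle eq_sym d0 row_dot_ge0.
  (* By homogeneity, maximality of [l] on the sphere extends to every nonzero [w]. *)
  pose u := (Num.sqrt d)^-1 *: w.
  have uE (M : 'M[R]_n.+1) : (u *m M *m u^T) 0 0 = (w *m M *m w^T) 0 0 / d.
    rewrite [u^T]linearZ /= -!scalemxAl -scalemxAr scalerA entryZ -invfM -expr2.
    by rewrite sqr_sqrtr ?ltW // mulrC.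
  have /vmax : u \in S.
    by apply/mem_set; rewrite /S /= -[u in u *m _]mulmx1 uE mulmx1 divff.
  by rewrite uE ler_pdivrMr.
by rewrite mulmxBr mulmxBl mul_mx_scalar -scalemxAl entryB entryZ Sv mulr1 subrr.
Qed.

(** The reflection along [w = v - e] exchanges the unit vectors [v] and [e]; if its squared length
    [2 - 2 a] is zero then [v = e] and the identity serves. *)
Lemma householder (R : rcfType) n (v : 'rV[R]_n.+1) : v *m v^T = 1%:M ->
  exists W : 'M[R]_n.+1, W *m W^T = 1%:M /\ row 0 W = v.
Proof.
move=> vv; pose e : 'rV[R]_n.+1 := delta_mx 0 0; pose w := v - e.
have eM (M : 'M[R]_n.+1) : e *m M = row 0 M by rewrite rowE.
have ee : e *m e^T = 1%:M.
  by rewrite trmx_delta mul_delta_mx; apply/matrixP => i j; rewrite !ord1 !mxE.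
pose a := (v *m e^T) 0 0.
have ve : v *m e^T = a%:M by exact: mx11_scalar.
have ev : e *m v^T = a%:M by rewrite -[e]trmxK -trmx_mul ve tr_scalar_mx.
have ww : w *m w^T = (2 - 2 * a)%:M.
  rewrite [w^T]linearB /= mulmxBl !mulmxBr vv ve ev ee.
  by rewrite -!raddfB /=; congr _%:M; ring.
have [d0|d0] := eqVneq (2 - 2 * a) 0.
  exists 1%:M; split; first by rewrite trmx1 mulmx1.
  rewrite row1; apply/esym/subr0_eq/row_dot_eq0.
  by rewrite ww d0 mxE.
pose c := 2 / (2 - 2 * a); pose P := w^T *m w.
have PT : P^T = P by rewrite trmx_mul trmxK.
have PP : P *m P = (2 - 2 * a) *: P.
  by rewrite mulmxA -(mulmxA w^T w) ww mul_mx_scalar -scalemxAl.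
exists (1%:M - c *: P); split.
  rewrite [(_ - _)^T]linearB /= [(c *: P)^T]linearZ /= PT trmx1.
  rewrite mulmxBl !mulmxBr !mul1mx mulmx1 -scalemxAl -scalemxAr PP !scalerA.
  rewrite (_ : c * c * _ = c + c); last by rewrite /c; field.
  by rewrite opprB scalerDl addrK subrK.
have ew : e *m w^T = (a - 1)%:M.
  by rewrite [w^T]linearB /= mulmxBr ev ee -raddfB.
rewrite -eM mulmxBr mulmx1 -scalemxAr mulmxA ew mul_scalar_mx scalerA.
rewrite (_ : c * _ = -1); last by rewrite /c; field.
by rewrite scaleN1r opprK addrC subrK.
Qed.

(** Deflation: in an orthonormal basis starting with an eigenvector, the first row of [A] is
    [(l, 0)]; by symmetry so is the first column, and induction applies to the remaining block. *)
Lemma real_spectral (R : realType) n (A : 'M[R]_n) : A^T = A ->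
  exists (W : 'M[R]_n) (d : 'rV[R]_n),
    W^T *m W = 1%:M /\ A = W *m diag_mx d *m W^T.
Proof.
elim: n A => [|n IH] A symA.
  by exists 1%:M, 0; split; rewrite [LHS]flatmx0 [RHS]flatmx0.
have [v [l [vv vA]]] := symmetric_eigenvector symA.
have [W0 [W0W0 rW0]] := householder vv.
have W0W0' : W0^T *m W0 = 1%:M by exact: mulmx1C.
(* [B] is kept opaque so that [mxE] does not unfold the product. *)
have [B defB] : exists B : 'M[R]_(1 + n), B = W0 *m A *m W0^T by eexists.
have symB : B^T = B by rewrite defB !trmx_mul trmxK symA mulmxA.
have row0B : row 0 B = l *: delta_mx 0 0.
  rewrite defB !row_mul rW0 vA -scalemxAl -rW0 -row_mul W0W0.
  by rewrite row1.
have Bur : ursubmx B = 0.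
  apply/matrixP => i j; rewrite !mxE ord1.
  have /rowP/(_ (rshift 1 j)) := row0B; rewrite !mxE /= mulr0 => <-.
  by congr (B _ _); apply: val_inj.
have Bdl : dlsubmx B = 0 by rewrite -[B]symB -trmx_ursub Bur trmx0.
have Bul : ulsubmx B = l%:M.
  apply/matrixP => i j; rewrite !ord1 !mxE /= mulr1n.
  have /rowP/(_ (lshift n 0)) := row0B; rewrite !mxE /= mulr1 => <-.
  by congr (B _ _); apply: val_inj.
have [|W [d [WW Bd]]] := IH (drsubmx B); first by rewrite trmx_drsub symB.
pose V : 'M[R]_(1 + n) := block_mx 1%:M 0 0 W.
have BE : B = V *m diag_mx (row_mx (l%:M : 'rV_1) d) *m V^T.
  rewrite diag_mx_row tr_block_mx !trmx0 trmx1 !mulmx_block.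
  rewrite !mul0mx !mulmx0 !mul1mx !mulmx1 !addr0 !add0r -[LHS]submxK.
  rewrite Bur Bdl Bul Bd; congr block_mx; rewrite ?mul0mx //.
  by apply/matrixP => i j; rewrite !ord1 !mxE.
have VV : V^T *m V = 1%:M.
  rewrite tr_block_mx !trmx0 trmx1 mulmx_block.
  by rewrite !mul0mx !mulmx0 !mul1mx !addr0 !add0r WW -scalar_mx_block.
pose dB : 'rV[R]_(1 + n) := row_mx (l%:M : 'rV_1) d.
exists (W0^T *m V); exists dB; rewrite /dB; split.
  by rewrite trmx_mul trmxK mulmxA -(mulmxA V^T) W0W0 mulmx1.
rewrite trmx_mul trmxK -[RHS]mulmxA.
have -> : W0^T *m V *m (diag_mx (row_mx (l%:M : 'rV_1) d) *m (V^T *m W0))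
  = W0^T *m B *m W0 by rewrite BE !mulmxA.
by rewrite defB !mulmxA W0W0' mul1mx -mulmxA W0W0' mulmx1.
Qed.

(** * Logarithms of rotations *)

Section Exp.
Variables (R : realType) (p : nat).
Implicit Types (Q L : 'M[R]_p) (N : {set 'I_p}).

(** Euler's formula: [L] commutes with [diag(t)] and squares to [-1] where [t] is nonzero. The
    factor [t i] in the second hypothesis leaves [L] free on rows of angle zero. *)
Lemma mxexp_rotation (t : 'I_p -> R) L :
  (forall i j, L i j != 0 -> t i = t j) ->
  (forall i j, t i * (L *m L) i j = - t i * (i == j)%:R) ->
  mxexp (\matrix_(i, j) (t i * L i j)) =
  \matrix_(i, j) (cos (t i) * (i == j)%:R + sin (t i) * L i j).
Proof.
move=> tL tLL; set A := \matrix_(_, _) _.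
have tLg i k (g : R -> R) : L i k * g (t k) = L i k * g (t i).
  by have [->|/tL ->//] := eqVneq (L i k) 0; rewrite !mul0r.
(* [c n] and [s n] are the cosine and sine terms without their factorials, so that
   [A^n = c n (t) + s n (t) L]. *)
pose c n (x : R) : R := (~~ odd n)%:R * (-1) ^+ n./2 * x ^+ n.
pose s n (x : R) : R := (odd n)%:R * (-1) ^+ n.-1./2 * x ^+ n.
have cS n x : c n.+1 x = - (x * s n x).
  rewrite /c /s /= negbK; case: n => [|n]; rewrite /= ?mul0r ?mulr0 ?oppr0 //.
  by rewrite !exprS; ring.
have sS n x : s n.+1 x = x * c n x by rewrite /c /s /= !exprS; ring.
have powA n i j : (A ^+ n) i j = c n (t i) * (i == j)%:R + s n (t i) * L i j.
  elim: n i j => [|n IH] i j.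
    by rewrite /c /s !expr0 mxE /= !mul1r !mul0r addr0.
  rewrite exprS -mulmxE mxE.
  under eq_bigr do rewrite mxE IH mulrDr.
  rewrite big_split /= (bigD1 j) //= big1 ?addr0 => [|k kj]; last first.
    by rewrite (negbTE kj) !mulr0.
  rewrite eqxx mulr1 -mulrA tLg.
  under eq_bigr => k _.
    rewrite [_ * L k j]mulrC mulrA -[_ * L i k * _ * _]mulrA.
    rewrite [L k j * _]mulrC mulrA -[_ * L i k * _]mulrA tLg.
    over.
  rewrite (eq_bigr (fun k => s n (t i) * (t i * (L i k * L k j)))) => [|k _].
    rewrite -!mulr_sumr; have -> : \sum_k L i k * L k j = (L *m L) i j.
      by rewrite mxE.
    by rewrite tLL cS sS; ring.
  by ring.
apply: mxexp_unique => i j; rewrite mxE.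
rewrite (_ : series _ = fun n => series (cos_coeff (t i)) n * (i == j)%:R
    + series (sin_coeff (t i)) n * L i j); last first.
  apply/funext => n; rewrite /series /= !mulr_suml -big_split /=.
  apply: eq_bigr => k _; rewrite powA /cos_coeff /sin_coeff /= /c /s.
  by rewrite -!exprnP; ring.
apply: cvgD; apply: cvgMr_tmp; rewrite unlock.
  exact: is_cvg_series_cos_coeff.
exact: is_cvg_series_sin_coeff.
Qed.

(* Pair up consecutive elements of an enumeration of [N]. *)
Lemma complex_structure_on N : ~~ odd #|N| ->
  exists J : 'M[R]_p, [/\ forall i j, J j i = - J i j,
    forall i j, J i j != 0 -> (i \in N) && (j \in N) &
    forall i j, i \in N -> (J *m J) i j = - (i == j)%:R].
Proof.
rewrite cardE; set s := enum N => evN.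
(* [flip] exchanges positions [2m] and [2m + 1]; as [s] has even size, it stays in range. *)
pose flip n := if odd n then n.-1 else n.+1.
have flip_lt n : (n < size s)%N -> (flip n < size s)%N.
  rewrite /flip; case: ifP => [_|on]; first exact: leq_ltn_trans (leq_pred n).
  rewrite leq_eqVlt => /orP[/eqP ns|//].
  by move: evN; rewrite -ns /= on.
have flipK n : flip (flip n) = n.
  rewrite /flip; case: n => [|n] //=; case: (boolP (odd n)) => [on|non] /=.
    by rewrite on.
  by rewrite (negbTE non).
have odd_flip n : odd (flip n) = ~~ odd n.
  rewrite /flip; case: n => [|n] //=.
  by case: (boolP (odd n)) => [on|/negbTE //] /=; rewrite on.
pose f i := nth i s (flip (index i s)).
have mems i : (i \in s) = (i \in N) by rewrite mem_enum.
have idx i : i \in N -> (index i s < size s)%N by rewrite index_mem mems.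
have fN i : i \in N -> f i \in N.
  by move=> iN; rewrite -mems mem_nth // flip_lt // idx.
have idxf i : i \in N -> index (f i) s = flip (index i s).
  by move=> iN; rewrite index_uniq ?enum_uniq // flip_lt // idx.
have fK i : i \in N -> f (f i) = i.
  move=> iN; rewrite {1}/f idxf // flipK (set_nth_default i) ?idx //.
  by rewrite nth_index // mems.
(* Signs alternate along the enumeration, so partners get opposite signs: [J] is a quarter turn on
   each pair. *)
pose e i : R := (-1) ^+ index i s.
have ef i : i \in N -> e (f i) = - e i.
  move=> iN; rewrite /e idxf // -signr_odd odd_flip -[in RHS]signr_odd.
  by case: odd; rewrite /= ?expr0 ?expr1 ?opprK.
have ee i : e i * e i = 1 by rewrite /e -expr2 sqrr_sign.
pose J : 'M[R]_p := \matrix_(i, j) (e i * ((i \in N) && (j == f i))%:R).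
exists J; split=> [i j|i j|i j iN].
- rewrite !mxE; have [/andP[jN /eqP ->]|H] := boolP ((j \in N) && (i == f j)).
    by rewrite fN // fK // eqxx ef // mulNr opprK.
  rewrite mulr0; have [/andP[iN /eqP ji]|_] := boolP ((i \in N) && (j == f i)).
    by move: H; rewrite ji fN // fK // eqxx.
  by rewrite mulr0 oppr0.
- rewrite mxE; have [/andP[iN /eqP ->]|_] := boolP ((i \in N) && (j == f i)).
    by rewrite iN fN.
  by rewrite mulr0 eqxx.
- rewrite mxE (bigD1 (f i)) //= big1 ?addr0 => [|k kf]; last first.
    by rewrite mxE (negbTE kf) andbF mulr0 mul0r.
  rewrite !mxE eqxx iN fN // fK // mulr1 ef // mulrA mulrN ee mulN1r.
  by rewrite eq_sym.
Qed.

(* An orthogonal matrix without eigenvalue [-1] has determinant [1]; flipping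
   the sign of the [-1]-eigenvectors reduces to that case. *)
Lemma even_card_eigenvalueN1 Q (c : 'I_p -> R) :
  Q *m Q^T = 1%:M -> \det Q = 1 ->
  (forall i j, Q i j + Q j i = 2 * c i * (i == j)%:R) ->
  (forall i j, Q i j != 0 -> c i = c j) ->
  ~~ odd #|[set i | c i == -1]%SET|.
Proof.
move=> QQ detQ Qc comm; set N := [set i | _]%SET.
pose e i : R := (-1) ^+ (i \in N).
have ee i : e i * e i = 1 by rewrite /e -expr2 sqrr_sign.
have eE i j : Q i j != 0 -> e i = e j.
  by move/comm => cij; rewrite /e /N !inE cij.
pose E : 'M[R]_p := diag_mx (\row_i e i).
have EE : E *m E^T = 1%:M.
  rewrite tr_diag_mx mulmx_diag; by apply/matrixP => i j; rewrite !mxE ee.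
pose P := Q *m E.
have PP : P *m P^T = 1%:M.
  by rewrite trmx_mul mulmxA -(mulmxA Q) EE mulmx1.
have PE i j : P i j = Q i j * e j by rewrite /P mul_mx_diag !mxE.
have detP1 : \det (P + 1%:M) != 0.
  (* The product is [2 + P + P']. Its diagonal entries are 4 on [N] and [2 + 2 c i] elsewhere, hence
     nonzero. *)
  have D : (P + 1%:M) *m (P + 1%:M)^T = diag_mx (\row_i (2 + 2 * (e i * c i))).
    rewrite [(_ + _)^T]linearD /= trmx1 mulmxDl !mulmxDr mulmx1 mul1mx PP mulmx1.
    apply/matrixP => i j; rewrite !entryD [P^T i j]mxE !PE.
    rewrite [LHS](_ : _ = 2 * (i == j)%:R + (Q i j * e j + Q j i * e i)); last first.
      by rewrite !mxE; ring.
    have -> : Q i j * e j = Q i j * e i.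
      by have [->|/eE ->//] := eqVneq (Q i j) 0; rewrite !mul0r.
    rewrite -mulrDl Qc !mxE; case: eqP => _; rewrite /= ?mulr1n ?mulr0n; ring.
  have : \det ((P + 1%:M) *m (P + 1%:M)^T) != 0.
    rewrite D det_diag; apply/prodf_neq0 => i _; rewrite mxE.
    rewrite (_ : 2 + _ = 2 * (1 + e i * c i)); last by ring.
    rewrite mulf_neq0 ?pnatr_eq0 // /e /N inE addrC addr_eq0.
    have [->|ci] := eqVneq (c i) (-1); last by rewrite mul1r.
    by rewrite mulrNN mulr1; apply/eqP; lra.
  by rewrite det_mulmx det_tr mulf_eq0 orbb.
have detP : \det P = 1.
  (* Taking determinants and cancelling [det (P + 1)] gives [det P = 1], whereas [det P = det E] is
     [-1] to the power [#|N|]. *)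
  have : P *m (P + 1%:M)^T = P + 1%:M.
    by rewrite [(P + _)^T]linearD /= trmx1 mulmxDr PP mulmx1 addrC.
  move/(congr1 determinant); rewrite det_mulmx det_tr => /esym.
  by rewrite -[LHS]mul1r => /(mulIf detP1) /esym.
move: detP; rewrite det_mulmx detQ mul1r det_diag.
under eq_bigr do rewrite mxE /e.
rewrite (bigID (mem N)) /= [X in _ * X]big1 => [|i /negbTE -> //].
rewrite mulr1 (eq_bigr (fun=> -1)) => [|i -> //].
rewrite prodr_const -signr_odd; case: odd => //= /eqP.
by rewrite expr1 -subr_eq0 -opprD oppr_eq0 (_ : 1 + 1 = 2%:R) // pnatr_eq0.
Qed.

End Exp.

(** * Surjectivity of the exponential onto rotations *)

Section Log.
Variables (R : realType) (p : nat).
Implicit Types (Q L : 'M[R]_p).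

Lemma rot_exp_surjective_diag_sympart Q (c : 'I_p -> R) :
  Q *m Q^T = 1%:M -> \det Q = 1 ->
  (forall i j, Q i j + Q j i = 2 * c i * (i == j)%:R) ->
  exists2 A, antisym A & mxexp A = Q.
Proof.
move=> QQ detQ Qc.
pose D : 'M[R]_p := diag_mx (\row_i c i).
(* [K] is kept opaque so that [mxE] does not unfold its entries. *)
have [K defK] : exists K, K = Q - D by eexists.
have KE i j : K i j = Q i j - c i * (i == j)%:R.
  by rewrite defK entryB !mxE mulr_natr.
have QT : Q^T = D + D - Q.
  apply/matrixP => i j; rewrite entryB entryD !mxE.
  by apply/eqP; rewrite eq_sym subr_eq addrC; apply/eqP; rewrite Qc mulr_natr; ring.
have KT i j : K j i = - K i j.
  have := Qc i j; rewrite !KE [j == i]eq_sym; case: eqP => [->|_] /=; lra.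
have QQ' : Q^T *m Q = 1%:M by exact: mulmx1C.
(* Substitute [Q' = 2 D - Q] into [Q Q' = Q' Q]. *)
have QD : Q *m D = D *m Q.
  move: QQ QQ'; rewrite QT mulmxBr mulmxBl !mulmxDr !mulmxDl => <- /addIr.
  move=> /matrixP H; apply/matrixP => i j; have := H i j.
  by rewrite !entryD => H'; lra.
have Qcomm i j : Q i j != 0 -> c i = c j.
  move=> q0; have /matrixP/(_ i j) := QD.
  by rewrite mul_mx_diag mul_diag_mx !mxE mulrC => /(mulIf q0) ->.
have Kcomm i j : K i j != 0 -> c i = c j.
  rewrite KE; case: (i =P j) => [->//|_]; rewrite mulr0 subr0; exact: Qcomm.
have KK i j : (K *m K) i j = (c i ^+ 2 - 1) * (i == j)%:R.
  have : K *m K = D *m D - 1%:M.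
    rewrite -QQ QT defK mulmxBl !mulmxBr !mulmxDr QD.
    by rewrite !opprB opprD !addrA; apply/matrixP => k l; rewrite !mxE; ring.
  move=> ->; rewrite entryB mulmx_diag !mxE mulrBl mul1r expr2.
  by rewrite mulr_natr.
(* The diagonal of [K^2], read with antisymmetry: it yields [|c i| <= 1] and the vanishing of row
   [i] of [K] when [c i] is 1 or -1. *)
have cK i : \sum_k K i k ^+ 2 = 1 - c i ^+ 2.
  have := KK i i; rewrite eqxx mulr1 mxE => H.
  rewrite -opprB -H -sumrN; apply: eq_bigr => k _.
  by rewrite [K k i]KT mulrN opprK expr2.
have c1 i : -1 <= c i <= 1.
  have : 0 <= 1 - c i ^+ 2 by rewrite -cK sumr_ge0 // => k _; rewrite sqr_ge0.
  by move=> ?; apply/andP; split; nra.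
have K0 i j : c i ^+ 2 = 1 -> K i j = 0.
  move=> ci; have /eqP := cK i; rewrite ci subrr psumr_eq0 => [|k _]; last first.
    by rewrite sqr_ge0.
  by move=> /allP/(_ j (mem_index_enum j)); rewrite sqrf_eq0 => /eqP.
have evN := even_card_eigenvalueN1 QQ detQ Qc Qcomm.
have [J [JT JN JJ]] := complex_structure_on R evN.
have JN1 i j : J i j != 0 -> c i = -1 /\ c j = -1.
  by move/JN; rewrite !inE => /andP[/eqP -> /eqP ->].
pose s i := Num.sqrt (1 - c i ^+ 2).
have s_ge i : 0 <= 1 - c i ^+ 2.
  by rewrite -cK sumr_ge0 // => k _; rewrite sqr_ge0.
have s2 i : s i ^+ 2 = 1 - c i ^+ 2 by rewrite sqr_sqrtr.
(* The two summands live on disjoint sets of rows: [|c i| < 1] for the first, [c i = -1] for [J].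
   Where [s i = 0] the quotient is 0; where [c i = 1] the whole row of [L] vanishes, and so does the
   angle. *)
pose L : 'M[R]_p := \matrix_(i, j) (K i j / s i + J i j).
have Lcomm i j : L i j != 0 -> c i = c j.
  rewrite mxE; have [->|/Kcomm//] := eqVneq (K i j) 0.
  by rewrite mul0r add0r => /JN1[-> ->].
have LT i j : L j i = - L i j.
  rewrite !mxE JT KT opprD -mulNr; congr (_ + _).
  have [->|/Kcomm E] := eqVneq (K i j) 0; first by rewrite oppr0 !mul0r.
  by rewrite /s E.
pose t i := acos (c i).
have cost i : cos (t i) = c i by rewrite /t acosK // in_itv /= c1.
have sint i : sin (t i) = s i by rewrite /t sin_acos.
have tLL i j : t i * (L *m L) i j = - t i * (i == j)%:R.
  have [ci1|ci1] := eqVneq (c i) 1; first by rewrite /t ci1 acos1 oppr0 !mul0r.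
  rewrite mulNr -mulrN; congr (_ * _); rewrite mxE.
  have [ciN|ciN] := eqVneq (c i) (-1).
    rewrite -JJ ?inE ?ciN // mxE; apply: eq_bigr => k _.
    have -> : L i k = J i k by rewrite mxE K0 ?mul0r ?add0r // ciN sqrrN expr1n.
    have [->|/JN1[_ ck]] := eqVneq (J i k) 0; first by rewrite !mul0r.
    congr (_ * _).
    by rewrite mxE K0 ?mul0r ?add0r // ck sqrrN expr1n.
  have s0 : s i ^+ 2 != 0.
    by rewrite s2 subr_eq0 eq_sym sqrf_eq1 negb_or ci1.
  have J0 k l : c k = c i -> J k l = 0.
    move=> ck; apply/eqP; apply: contraNT ciN => /JN1[].
    by rewrite ck => ->.
  transitivity (\sum_k K i k * K k j / s i ^+ 2).
    apply: eq_bigr => k _.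
    rewrite ![L _ _]mxE (J0 i) // addr0.
    have [->|/Kcomm cik] := eqVneq (K i k) 0; first by rewrite !mul0r.
    by rewrite (J0 k) // addr0 /s -cik expr2 invfM; ring.
  rewrite -mulr_suml; have -> : \sum_k K i k * K k j = (K *m K) i j by rewrite mxE.
  rewrite KK -opprB -s2; case: eqP => _; rewrite /= ?mulr0 ?mul0r ?oppr0 // !mulr1.
  by rewrite mulNr divff.
exists (\matrix_(i, j) (t i * L i j)).
  apply/matrixP => i j; rewrite [LHS]mxE [LHS]mxE [RHS]mxE [in RHS]mxE LT.
  rewrite mulrN; congr (- _).
  have [->|] := eqVneq (L i j) 0; first by rewrite !mulr0.
  by move/Lcomm => cij; rewrite /t cij.
rewrite mxexp_rotation //; last by move=> i j /Lcomm cij; rewrite /t cij.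
apply/matrixP => i j; rewrite mxE cost sint [L i j]mxE.
have [si0|si0] := eqVneq (s i) 0.
  rewrite si0 mul0r addr0; have := KE i j; rewrite K0.
    by move/eqP; rewrite eq_sym subr_eq0 => /eqP.
  by apply/eqP; rewrite eq_sym -subr_eq0 -s2 si0 expr0n.
have -> : J i j = 0.
  apply/eqP; apply: contraNT si0 => /JN1[ci _].
  by rewrite -sqrf_eq0 s2 ci sqrrN expr1n subrr.
by rewrite addr0 [s i * _]mulrC mulfVK // KE addrC subrK.
Qed.

(** Conjugation by an orthonormal eigenbasis [W] of the symmetric part of [Q] reduces to the
    diagonal case. [W] may have determinant -1, but conjugation preserves [det Q]. *)
Lemma rot_exp_surjective Q : SO Q -> exists2 A, antisym A & mxexp A = Q.
Proof.
move=> [QQ detQ].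
have [|W [d [WW E]]] := @real_spectral R p (2^-1 *: (Q + Q^T)).
  by rewrite [LHS]linearZ /= [(Q + _)^T]linearD /= trmxK addrC.
have WW' : W *m W^T = 1%:M by exact: mulmx1C.
pose P := W^T *m Q *m W.
have PE : W *m P *m W^T = Q.
  by rewrite /P !mulmxA WW' mul1mx -mulmxA WW' mulmx1.
have PT : P^T = W^T *m Q^T *m W by rewrite !trmx_mul trmxK mulmxA.
have [|||A antiA expA] := @rot_exp_surjective_diag_sympart P (d 0).
- by rewrite PT /P -!mulmxA (mulmxA W W^T) WW' mul1mx (mulmxA Q) QQ mul1mx.
- by rewrite /P !det_mulmx detQ mulr1 -det_mulmx WW det1.
- move=> i j; have : P + P^T = 2 *: diag_mx d.
    rewrite PT /P -mulmxDl -mulmxDr.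
    have -> : Q + Q^T = 2 *: (W *m diag_mx d *m W^T).
      by rewrite -E scalerA divff ?pnatr_eq0 // scale1r.
    rewrite -scalemxAr -scalemxAl !mulmxA WW mul1mx -mulmxA WW mulmx1.
    by [].
  move=> /matrixP/(_ i j); rewrite !mxE => ->.
  by rewrite -mulrA mulr_natr.
exists (W *m A *m W^T).
  by rewrite /antisym /= !trmx_mul trmxK antiA mulNmx mulmxN mulmxA.
by rewrite mxexp_conj // expA PE.
Qed.

End Log.

(** * Minimal logarithms *)

Lemma closed_level_set (R : realType) (T : topologicalType) (f : T -> R) y :
  continuous f -> closed [set x | f x = y].
Proof. by move=> cf; exact: ((continuous_closedP f).1 cf _ (@closed_eq R y)). Qed.

Lemma closed_sublevel_set (R : realType) (T : topologicalType) (f : T -> R) y :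
  continuous f -> closed [set x | f x <= y].
Proof. by move=> cf; exact: ((continuous_closedP f).1 cf _ (@closed_le R y)). Qed.

Section MinimalLog.
Variables (R : realType) (p : nat).
Implicit Types (A B P Q W : 'M[R]_p).

Lemma mxexp_coord_continuous i j : continuous (fun A : 'M[R]_p => mxexp A i j).
Proof.
move=> A; have FA : Filter (nbhs A) by exact: nbhs_filter.
apply/cvgrPdist_le => e e0.
(* Large enough to bound the entries of every [B] within distance 1 of [A], so that a single
   Lipschitz constant [C] serves. *)
pose a : R := \sum_k \sum_l `|A k l| + 1.
have Aa k l : `|A k l| + 1 <= a.
  rewrite lerD2r (bigD1 k) //= (bigD1 l) //= -addrA lerDl.
  by rewrite addr_ge0 //; do ?[apply: sumr_ge0 => ? _].
pose C : R := p%:R * expR (p%:R * a).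
have C0 : 0 <= C by rewrite mulr_ge0 // expR_ge0.
pose d := Num.min 1 (e / (C + 1)).
have d0 : 0 < d by rewrite lt_min ltr01 divr_gt0 // ltr_wpDl.
exists (fun k l => ball (A k l) d) => [k l|B AB] /=; first exact: nbhsx_ballx.
have ABd k l : `|A k l - B k l| <= d by apply: ltW; exact: AB.
apply: (@le_trans _ _ (p%:R * d * expR (p%:R * a))).
  apply: mxexp_entry_lipschitz => // k l.
    by apply: le_trans (Aa k l); rewrite lerDl.
  apply: le_trans (Aa k l).
  rewrite -[B k l](subKr (A k l)); apply: le_trans (ler_normB _ _) _.
  by rewrite lerD2l (le_trans (ABd k l)) // ge_min lexx.
rewrite mulrAC -/C; apply: (@le_trans _ _ (C * (e / (C + 1)))).
  by rewrite ler_wpM2l // ge_min lexx orbT.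
rewrite mulrCA -[leRHS]mulr1 ler_wpM2l ?(ltW e0) //.
by rewrite ler_pdivrMr ?mul1r ?lerDl // ltr_wpDl.
Qed.

(** The image of a compact box of row vectors under the continuous map [vec_mx]. *)
Lemma mx_box_compact (r : R) : compact [set A : 'M[R]_p | forall i j, `|A i j| <= r].
Proof.
have cbox := @rV_compact R (p * p) (fun=> `[- r, r]%classic)
  (fun=> @segment_compact R (- r) r).
have cvec : continuous (vec_mx : 'rV[R]_(p * p) -> 'M[R]_p).
  move=> u; have Fu : Filter (nbhs u) by exact: nbhs_filter.
  apply: cvg_mx_coord => i j; rewrite mxE.
  under eq_fun do rewrite mxE.
  exact: coord_continuous.
have := continuous_compact (continuous_subspaceT cvec) cbox.
congr compact; apply/seteqP; split=> [_ [u ur <-] i j|A Ar] /=.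
  by have := ur (mxvec_index i j); rewrite mxE /= in_itv /= ler_norml.
exists (mxvec A); last exact: mxvecK.
by case/mxvec_indexP => i j /=; rewrite mxvecE in_itv /= -ler_norml.
Qed.

Lemma sqr_frobenius A : frobenius A ^+ 2 = \sum_i \sum_j A i j ^+ 2.
Proof.
by rewrite sqr_sqrtr // sumr_ge0 // => i _; rewrite sumr_ge0 // => j _; rewrite sqr_ge0.
Qed.

Lemma frobenius_ge0 A : 0 <= frobenius A.
Proof. exact: sqrtr_ge0. Qed.

Lemma sqr_frobenius_continuous : continuous (fun A : 'M[R]_p => frobenius A ^+ 2).
Proof.
under eq_fun do rewrite sqr_frobenius.
move=> A; have FA : Filter (nbhs A) by exact: nbhs_filter.
apply: cvg_big => [|i _]; first exact: add_continuous.
apply: cvg_big => [|j _]; first exact: add_continuous.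
by apply: cvgM; exact: coord_continuous.
Qed.

Lemma entry_le_frobenius A i j : `|A i j| <= frobenius A.
Proof.
rewrite -(@ler_pXn2r _ 2) ?nnegrE ?frobenius_ge0 // sqr_frobenius.
rewrite real_normK ?num_real // (bigD1 i) //= (bigD1 j) //= -addrA lerDl.
by rewrite addr_ge0 ?sumr_ge0 // => k _; rewrite ?sumr_ge0 // => *; rewrite sqr_ge0.
Qed.

Lemma is_rot_log_exists Q : SO Q -> exists A, is_rot_log Q A.
Proof.
move=> /rot_exp_surjective[A0 anti0 exp0].
(* The cut-off at the norm of one known logarithm [A0] gives compactness; logarithms outside [S] are
   longer than [A0] and cannot beat the minimizer. *)
pose S := [set A : 'M[R]_p | [/\ antisym A, mxexp A = Q & frobenius A <= frobenius A0]].
have closedS : closed S.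
  have -> : S = (\bigcap_ij [set A : 'M[R]_p | A ij.2 ij.1 + A ij.1 ij.2 = 0])
      `&` (\bigcap_ij [set A : 'M[R]_p | mxexp A ij.1 ij.2 = Q ij.1 ij.2])
      `&` [set A : 'M[R]_p | frobenius A ^+ 2 <= frobenius A0 ^+ 2].
    have frobE A : (frobenius A ^+ 2 <= frobenius A0 ^+ 2)
        = (frobenius A <= frobenius A0).
      by rewrite ler_pXn2r // nnegrE frobenius_ge0.
    apply/seteqP; split=> A.
      move=> [antiA expA AA0]; split; last by rewrite /= frobE.
      split=> -[i j] _ /=; last by rewrite expA.
      by have /matrixP/(_ i j) := antiA; rewrite !mxE => ->; rewrite addNr.
    move=> [[antiA expA]]; rewrite /= frobE => AA0; split=> //.
      apply/matrixP => i j; rewrite !mxE; apply/eqP.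
      by rewrite -addr_eq0; apply/eqP; exact: (antiA (i, j)).
    by apply/matrixP => i j; exact: (expA (i, j)).
  apply: closedI; first apply: closedI.
  - apply: closed_bigI => -[i j] _ /=.
    apply: (@closed_level_set _ _ (fun A : 'M[R]_p => A j i + A i j)) => A.
    have FA : Filter (nbhs A) by exact: nbhs_filter.
    by apply: cvgD; exact: coord_continuous.
  - apply: closed_bigI => -[i j] _ /=.
    by apply: (@closed_level_set _ _ (fun A : 'M[R]_p => mxexp A i j));
      exact: mxexp_coord_continuous.
  - by apply: (@closed_sublevel_set _ _ (fun A : 'M[R]_p => frobenius A ^+ 2));
      exact: sqr_frobenius_continuous.
have compactS : compact S.
  apply: subclosed_compact closedS (@mx_box_compact (frobenius A0)) _.
  by move=> A [_ _ AA0] i j; exact: le_trans (entry_le_frobenius A i j) AA0.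
have S0 : S !=set0 by exists A0; split.
have := compact_EVT_min S0 compactS
  (continuous_subspaceT sqr_frobenius_continuous).
move=> [A /set_mem[antiA expA AA0] minA]; exists A; split=> // B antiB expB.
have [BA0|/ltW] := leP (frobenius B) (frobenius A0); last exact: le_trans.
rewrite -(@ler_pXn2r _ 2) ?nnegrE ?frobenius_ge0 //.
by apply: minA; apply/mem_set.
Qed.

Lemma rot_logP Q : SO Q -> is_rot_log Q (rot_log Q).
Proof. by move=> /is_rot_log_exists; exact: xgetPex. Qed.

(** Two minimal logarithms bound each other's norm, so the distance does not depend on the choice
    made by [rot_log]. *)
Lemma frobenius_rot_log Q A : SO Q -> is_rot_log Q A ->
  frobenius (rot_log Q) = frobenius A.
Proof.
move=> /rot_logP[antiL expL minL] [antiA expA minA].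
by apply: le_anti; rewrite minL // minA.
Qed.

(** * Norms of minimal logarithms under transposition and conjugation *)

Lemma frobenius_tr A : frobenius A^T = frobenius A.
Proof.
congr Num.sqrt; rewrite exchange_big.
by apply: eq_bigr => i _; apply: eq_bigr => j _; rewrite mxE.
Qed.

Lemma frobeniusE A : frobenius A = Num.sqrt (\tr (A *m A^T)).
Proof.
congr Num.sqrt; apply: eq_bigr => i _; rewrite mxE.
by apply: eq_bigr => j _; rewrite mxE expr2.
Qed.

Lemma frobenius_conj W A : W^T *m W = 1%:M ->
  frobenius (W *m A *m W^T) = frobenius A.
Proof.
move=> WW; rewrite !frobeniusE !trmx_mul trmxK -!mulmxA (mulmxA W^T) WW mul1mx.
by rewrite mxtrace_mulC -!mulmxA WW mulmx1.
Qed.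

Lemma frobenius0 : frobenius (0 : 'M[R]_p) = 0.
Proof. by rewrite frobeniusE mul0mx linear0 sqrtr0. Qed.

Lemma antisym_tr A : antisym A -> antisym A^T.
Proof. by rewrite /antisym /= => antiA; rewrite [in LHS]antiA linearN. Qed.

Lemma antisym_conj W A : antisym A -> antisym (W *m A *m W^T).
Proof.
by rewrite /antisym /= !trmx_mul trmxK => ->; rewrite mulNmx mulmxN mulmxA.
Qed.

Lemma SO_tr Q : SO Q -> SO Q^T.
Proof. by move=> [QQ detQ]; split; rewrite ?det_tr // trmxK; exact: mulmx1C. Qed.

Lemma SO_mul P Q : SO P -> SO Q -> SO (P *m Q).
Proof.
move=> [PP detP] [QQ detQ]; split; last by rewrite det_mulmx detP detQ mulr1.
by rewrite trmx_mul -mulmxA (mulmxA Q) QQ mul1mx.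
Qed.

Lemma SO1 : SO (1%:M : 'M[R]_p).
Proof. by split; rewrite ?det1 // trmx1 mulmx1. Qed.

(** Transposition is a norm-preserving involution that exchanges the antisymmetric logarithms of [Q]
    and of its transpose. *)
Lemma frobenius_rot_log_tr Q : SO Q ->
  frobenius (rot_log Q^T) = frobenius (rot_log Q).
Proof.
move=> SQ; have [antiA expA minA] := rot_logP SQ.
rewrite -[RHS]frobenius_tr; apply: frobenius_rot_log; first exact: SO_tr.
split=> [||B antiB expB]; first exact: antisym_tr.
  by rewrite mxexp_tr expA.
rewrite frobenius_tr -(frobenius_tr B); apply: minA; first exact: antisym_tr.
by rewrite mxexp_tr expB trmxK.
Qed.

Lemma frobenius_rot_log_conj W Q : SO W -> SO Q ->
  frobenius (rot_log (W *m Q *m W^T)) = frobenius (rot_log Q).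
Proof.
move=> SW SQ; have [WW' _] := SW; have WW := mulmx1C WW'.
have [antiA expA minA] := rot_logP SQ.
rewrite -(frobenius_conj (rot_log Q) WW); apply: frobenius_rot_log.
  by do 2?apply: SO_mul => //; exact: SO_tr.
split=> [||B antiB expB]; first exact: antisym_conj.
  by rewrite mxexp_conj // expA.
have WW2 : W^T^T *m W^T = 1%:M by rewrite trmxK.
rewrite frobenius_conj // -(frobenius_conj B WW2); apply: minA.
  exact: antisym_conj.
by rewrite mxexp_conj // expB trmxK !mulmxA WW mul1mx -mulmxA WW mulmx1.
Qed.

Lemma frobenius_rot_log1 : frobenius (rot_log (1%:M : 'M[R]_p)) = 0.
Proof.
rewrite -frobenius0; apply: frobenius_rot_log; first exact: SO1.
split=> [||B _ _]; first by rewrite /antisym /= trmx0 oppr0.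
  exact: mxexp0.
by rewrite frobenius0 frobenius_ge0.
Qed.

End MinimalLog.

(** * The scaling-rotation distance *)

Section ScalingRotation.
Variables (R : realType) (p : nat).
Implicit Types (A B D L Q U V X Y : 'M[R]_p) (a b : 'M[R]_p * 'M[R]_p).

Lemma DiagPosE D : DiagPos D -> D = diag_mx (\row_i D i i).
Proof.
move=> [/is_diag_mxP diagD _]; apply/matrixP => i j; rewrite !mxE.
by case: (eqVneq i j) => [->|ij]; rewrite ?mulr1n // mulr0n diagD.
Qed.

Lemma DiagPos_diag (d : 'rV[R]_p) : (forall i, 0 < d 0 i) -> DiagPos (diag_mx d).
Proof.
move=> d0; split=> [|i]; first exact: diag_mx_is_diag.
by rewrite mxE eqxx mulr1n.
Qed.

Lemma DiagPos_mulV D : DiagPos D ->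
  D *m diag_mx (\row_i (D i i)^-1) = 1%:M.
Proof.
move=> posD; have [_ D0] := posD; rewrite {1}(DiagPosE posD) mulmx_diag.
apply/matrixP => i j; rewrite !mxE.
by rewrite divff // gt_eqF.
Qed.

Lemma mulmx1_invmx A B : A *m B = 1%:M -> invmx A = B.
Proof.
move=> AB; have [uA _] := mulmx1_unit AB.
by rewrite -[invmx A]mulmx1 -AB mulmxA mulVmx // mul1mx.
Qed.

Lemma DiagPos_invmx D : DiagPos D -> invmx D = diag_mx (\row_i (D i i)^-1).
Proof. by move=> /DiagPos_mulV; exact: mulmx1_invmx. Qed.

Lemma DiagPos_inv D : DiagPos D -> DiagPos (invmx D).
Proof.
move=> posD; rewrite DiagPos_invmx //; apply: DiagPos_diag => i.
by rewrite mxE invr_gt0; case: posD.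
Qed.

Lemma DiagPos_scale (s : R) D : 0 < s -> DiagPos D -> DiagPos (s *: D).
Proof.
move=> s0 posD; have [_ D0] := posD; rewrite (DiagPosE posD) -linearZ /=.
by apply: DiagPos_diag => i; rewrite !mxE mulr_gt0.
Qed.

Lemma sqr_frobenius_diag_log L D : DiagPos L -> DiagPos D ->
  frobenius (diag_log (L *m invmx D)) ^+ 2 = \sum_i ln (L i i / D i i) ^+ 2.
Proof.
move=> posL posD; rewrite sqr_frobenius; apply: eq_bigr => i _.
rewrite (bigD1 i) //= big1 => [|j /negbTE ij].
  rewrite addr0 !mxE eqxx mulr1n; congr (ln _ ^+ 2).
  rewrite (DiagPos_invmx posD) (bigD1 i) //= big1 => [|j /negbTE ij].
    by rewrite !mxE eqxx mulr1n addr0.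
  by rewrite !mxE ij mulr0.
by rewrite !mxE eq_sym ij expr0n.
Qed.

(** * Symmetry and invariance of the geodesic distance and of its infimum *)

Lemma geo_dist_ge0 (k : R) a b : 0 <= geo_dist k a b.
Proof. exact: sqrtr_ge0. Qed.

Lemma geo_distE (k : R) a b X Y : eigen_decomp X a -> eigen_decomp Y b ->
  geo_dist k a b = Num.sqrt (k / 2 * frobenius (rot_log (b.1 *m a.1^T)) ^+ 2
    + \sum_i ln (b.2 i i / a.2 i i) ^+ 2).
Proof.
by move=> [_ pa _] [_ pb _]; rewrite /geo_dist sqr_frobenius_diag_log.
Qed.

Lemma ln_sqrV (x y : R) : 0 < x -> 0 < y -> ln (x / y) ^+ 2 = ln (y / x) ^+ 2.
Proof. by move=> x0 y0; rewrite -[x / y]invf_div lnV ?sqrrN // posrE divr_gt0. Qed.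

(** Swapping the arguments transposes the relative rotation and negates each log-ratio. *)
Lemma geo_dist_sym (k : R) a b X Y : eigen_decomp X a -> eigen_decomp Y b ->
  geo_dist k a b = geo_dist k b a.
Proof.
move=> Ea Eb; rewrite (geo_distE k Ea Eb) (geo_distE k Eb Ea).
case: Ea Eb => [Sa [_ a0] _] [Sb [_ b0] _]; congr (Num.sqrt (_ * _ ^+ 2 + _)).
  rewrite -frobenius_rot_log_tr; last by apply: SO_mul => //; exact: SO_tr.
  by rewrite trmx_mul trmxK.
by apply: eq_bigr => i _; rewrite ln_sqrV.
Qed.

Lemma geo_distxx (k : R) a X : eigen_decomp X a -> geo_dist k a a = 0.
Proof.
move=> Ea; rewrite (geo_distE k Ea Ea); case: Ea => [[aa _] [_ a0] _].
rewrite aa frobenius_rot_log1 expr0n mulr0 add0r big1 ?sqrtr0 // => i _.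
by rewrite divff ?gt_eqF // ln1 expr0n.
Qed.

Lemma eigen_decomp_inv X a : eigen_decomp X a ->
  eigen_decomp (invmx X) (a.1, invmx a.2).
Proof.
move=> [Sa pa ->]; split=> //=; first exact: DiagPos_inv.
have [aa _] := Sa; apply: mulmx1_invmx.
rewrite -!mulmxA (mulmxA a.1^T) (mulmx1C aa) mul1mx (mulmxA a.2).
by rewrite mulmxV ?mul1mx //; case/mulmx1_unit: (DiagPos_mulV pa).
Qed.

Lemma geo_dist_inv (k : R) a b X Y : eigen_decomp X a -> eigen_decomp Y b ->
  geo_dist k (a.1, invmx a.2) (b.1, invmx b.2) = geo_dist k a b.
Proof.
move=> Ea Eb; rewrite (geo_distE k Ea Eb).
rewrite (geo_distE k (eigen_decomp_inv Ea) (eigen_decomp_inv Eb)) /=.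
case: Ea Eb => [_ pa _] [_ pb _]; congr (Num.sqrt (_ + _)).
apply: eq_bigr => i _; rewrite !DiagPos_invmx // !mxE eqxx !mulr1n.
have [[_ a0] [_ b0]] := (pa, pb).
by rewrite invrK [(_ i i)^-1 * _]mulrC ln_sqrV.
Qed.

Lemma eigen_decomp_scale_conj (s : R) Q X a : 0 < s -> SO Q ->
  eigen_decomp X a ->
  eigen_decomp (s *: (Q *m X *m Q^T)) (Q *m a.1, s *: a.2).
Proof.
move=> s0 SQ [Sa pa ->]; split=> /=; first exact: SO_mul.
  exact: DiagPos_scale.
by rewrite trmx_mul -scalemxAr -!scalemxAl !mulmxA.
Qed.

(** The relative rotation is conjugated by [Q], and [s] cancels in each ratio of eigenvalues. *)
Lemma geo_dist_scale_conj (k s : R) Q a b X Y : 0 < s -> SO Q ->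
  eigen_decomp X a -> eigen_decomp Y b ->
  geo_dist k (Q *m a.1, s *: a.2) (Q *m b.1, s *: b.2) = geo_dist k a b.
Proof.
move=> s0 SQ Ea Eb; rewrite (geo_distE k Ea Eb).
rewrite (geo_distE k (eigen_decomp_scale_conj s0 SQ Ea)
  (eigen_decomp_scale_conj s0 SQ Eb)) /=.
case: Ea Eb => [Sa pa _] [Sb pb _]; congr (Num.sqrt (_ * _ ^+ 2 + _)).
  rewrite trmx_mul mulmxA -(mulmxA Q) frobenius_rot_log_conj //.
  by apply: SO_mul => //; exact: SO_tr.
apply: eq_bigr => i _; rewrite !mxE invfM mulrACA divff ?mul1r //.
by rewrite gt_eqF.
Qed.

(** Each map transports pairs of decompositions without changing their distance, so the two sets
    under the infimum include each other. *)
Lemma eq_sr_dist (k : R) X Y X' Y'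
    (f g : 'M[R]_p * 'M[R]_p -> 'M[R]_p * 'M[R]_p) :
  (forall a, eigen_decomp X a -> eigen_decomp X' (f a)) ->
  (forall b, eigen_decomp Y b -> eigen_decomp Y' (f b)) ->
  (forall a, eigen_decomp X' a -> eigen_decomp X (g a)) ->
  (forall b, eigen_decomp Y' b -> eigen_decomp Y (g b)) ->
  (forall a b, eigen_decomp X a -> eigen_decomp Y b ->
    geo_dist k (f a) (f b) = geo_dist k a b) ->
  (forall a b, eigen_decomp X' a -> eigen_decomp Y' b ->
    geo_dist k (g a) (g b) = geo_dist k a b) ->
  sr_dist k X Y = sr_dist k X' Y'.
Proof.
move=> fX fY gX gY ff gg; congr inf; apply/seteqP.
split=> _ [a Ea [b Eb <-]].
  by exists (f a); [exact: fX | exists (f b); [exact: fY | exact: ff]].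
by exists (g a); [exact: gX | exists (g b); [exact: gY | exact: gg]].
Qed.

Lemma sr_dist_inv (k : R) X Y :
  sr_dist k X Y = sr_dist k (invmx X) (invmx Y).
Proof.
apply: (@eq_sr_dist _ _ _ _ _ (fun a => (a.1, invmx a.2))
                              (fun a => (a.1, invmx a.2))) => [a|a|a|a|a b|a b].
- exact: eigen_decomp_inv.
- exact: eigen_decomp_inv.
- by move/eigen_decomp_inv; rewrite invmxK.
- by move/eigen_decomp_inv; rewrite invmxK.
- exact: geo_dist_inv.
- exact: geo_dist_inv.
Qed.

Lemma sr_dist_scale_conj (k s : R) Q X Y : 0 < s -> SO Q ->
  sr_dist k X Y = sr_dist k (s *: (Q *m X *m Q^T)) (s *: (Q *m Y *m Q^T)).
Proof.
move=> s0 SQ; have SQT := SO_tr SQ.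
have s0' : 0 < s^-1 by rewrite invr_gt0.
have QQ : Q^T *m Q = 1%:M by apply: mulmx1C; case: SQ.
have unscale Z : s^-1 *: (Q^T *m (s *: (Q *m Z *m Q^T)) *m Q^T^T) = Z.
  rewrite -scalemxAr -scalemxAl scalerA mulVf ?gt_eqF // scale1r trmxK.
  by rewrite !mulmxA QQ mul1mx -mulmxA QQ mulmx1.
apply: (@eq_sr_dist _ _ _ _ _ (fun a => (Q *m a.1, s *: a.2))
  (fun a => (Q^T *m a.1, s^-1 *: a.2))) => [a|a|a|a|a b|a b].
- exact: eigen_decomp_scale_conj.
- exact: eigen_decomp_scale_conj.
- by move/(eigen_decomp_scale_conj s0' SQT); rewrite unscale.
- by move/(eigen_decomp_scale_conj s0' SQT); rewrite unscale.
- exact: geo_dist_scale_conj.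
- exact: geo_dist_scale_conj.
Qed.

Lemma sr_dist_sym (k : R) X Y : sr_dist k X Y = sr_dist k Y X.
Proof.
congr inf; apply/seteqP; split=> _ [a Ea [b Eb <-]]; exists b => //;
  by exists a => //; rewrite (geo_dist_sym k Eb Ea).
Qed.

(** The spectral theorem only gives an orthogonal [W]; if its determinant is -1, changing the sign
    of one column makes it a rotation and leaves the diagonal factor unchanged. *)
Lemma eigen_decomp_exists X : SymPos X -> exists a, eigen_decomp X a.
Proof.
move=> [symX posX]; have [W [d [WW XE]]] := real_spectral symX.
have WW' : W *m W^T = 1%:M by exact: mulmx1C.
have d0 i : 0 < d 0 i.
  (* Each eigenvalue is the value of the form at a column of [W], which is nonzero since
     [W' W = 1]. *)
  have : (col i W)^T *m X *m col i W = (d 0 i)%:M.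
    rewrite !colE trmx_mul trmx_delta XE !mulmxA -(mulmxA _ W^T W) WW mulmx1.
    rewrite -(mulmxA _ W^T W) WW mulmx1 -rowE row_diag_mx -scalemxAl.
    by rewrite mul_delta_mx -scalemx1; congr (_ *: _); apply/matrixP => u v;
      rewrite !ord1 !mxE.
  move=> q; have := posX (col i W); rewrite q mxE eqxx mulr1n; apply.
  apply/eqP => Wi0; have /matrixP/(_ i i) := WW.
  rewrite !mxE eqxx => /eqP; rewrite big1 => [|k _].
    by rewrite eq_sym oner_eq0.
  have /matrixP/(_ k 0) := Wi0; rewrite !mxE => ->; exact: mulr0.
have detW : \det W * \det W = 1.
  by rewrite -{1}det_tr -det_mulmx WW det1.
have [detW1|detWN] := eqVneq (\det W) 1.
  by exists (W, diag_mx d); split=> //=; exact: DiagPos_diag.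
have {detWN}detWN : \det W = -1.
  by move/eqP: detW; rewrite -expr2 sqrf_eq1 (negbTE detWN) => /eqP.
(* There is a column to flip: for [p = 0] the determinant would be 1. *)
have [i0 _] : exists i0 : 'I_p, True.
  case: p W detWN {WW XE WW' d0 detW} => [|n] W.
    by rewrite det_mx00 => /eqP; rewrite -subr_eq0 opprK -mulr2n pnatr_eq0.
  by exists ord0.
pose e : 'rV[R]_p := \row_i (if i == i0 then -1 else 1).
pose E := diag_mx e.
have EE : E *m E = 1%:M.
  rewrite mulmx_diag; apply/matrixP => i j; rewrite !mxE.
  by case: ifP; rewrite ?mulrNN mulr1.
have EDE : E *m diag_mx d *m E = diag_mx d.
  rewrite !mulmx_diag; congr diag_mx; apply/rowP => i; rewrite !mxE.
  by case: ifP => _; rewrite ?mulN1r ?mulrN1 ?opprK // mul1r mulr1.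
have ET : E^T = E by rewrite tr_diag_mx.
exists (W *m E, diag_mx d); split=> /=; last 2 first.
- exact: DiagPos_diag.
- by rewrite XE trmx_mul ET !mulmxA -(mulmxA W E) -(mulmxA W _ E) EDE.
split; first by rewrite trmx_mul ET -mulmxA (mulmxA E) EE mul1mx.
rewrite det_mulmx detWN det_diag (bigD1 i0) //= mxE eqxx big1 => [|i ii0].
  by rewrite mulr1 mulrNN mulr1.
by rewrite mxE (negbTE ii0).
Qed.

End ScalingRotation.

(** * Separation of points and the semi-metric axioms *)

Section Separation.
Variables (R : realType) (p : nat).
Implicit Types (A B D L Q U V X Y : 'M[R]_p) (a b : 'M[R]_p * 'M[R]_p).

Lemma orthogonal_entry_le1 Q i j : Q *m Q^T = 1%:M -> `|Q i j| <= 1.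
Proof.
move=> /matrixP/(_ i i); rewrite mxE mxE eqxx mulr1n => QQ.
rewrite -(@ler_pXn2r _ 2) ?nnegrE // expr1n real_normK ?num_real // -QQ.
rewrite (bigD1 j) //= mxE -expr2 lerDl sumr_ge0 // => k _.
by rewrite mxE -expr2 sqr_ge0.
Qed.

Lemma conj_diag_entry_le Q (d : 'I_p -> R) i j : Q *m Q^T = 1%:M ->
  `|(Q *m diag_mx (\row_i d i) *m Q^T) i j| <= \sum_k `|d k|.
Proof.
move=> QQ; rewrite mul_mx_diag mxE; apply: le_trans (ler_norm_sum _ _ _) _.
apply: ler_sum => k _; rewrite !mxE !normrM.
have Q1 l := orthogonal_entry_le1 l k QQ.
rewrite mulrAC -[leRHS]mul1r ler_wpM2r //.
by rewrite -[leRHS]mul1r ler_pM.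
Qed.

(** Makes the estimates uniform: the trace depends on the conjugated matrix and not on its chosen
    decomposition. *)
Lemma conj_diag_trace Q D : Q *m Q^T = 1%:M -> DiagPos D ->
  \tr (Q *m D *m Q^T) = \sum_k `|D k k|.
Proof.
move=> QQ [_ D0]; rewrite mxtrace_mulC mulmxA (mulmx1C QQ) mul1mx.
by apply: eq_bigr => k _; rewrite gtr0_norm.
Qed.

(** The inequality [1 + z <= exp z] at [z = ln r] and [z = - ln r] gives [1 - e <= r] and
    [(1 - e) r <= 1]; for [e <= 1/2] also [1 <= (1 - e) (1 + 2 e)], whence [r <= 1 + 2 e]. *)
Lemma ln_ratio_dist (x y e : R) : 0 < x -> 0 < y -> 0 <= e <= 2^-1 ->
  `|ln (y / x)| <= e -> `|y - x| <= 2 * e * x.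
Proof.
move=> x0 y0 /andP[e0 e2] lne; pose r := y / x.
have r0 : 0 < r by rewrite divr_gt0.
have yE : y = r * x by rewrite divfK // gt_eqF.
move: lne; rewrite -/r ler_norml => /andP[l1 l2].
have r1 : 1 - e <= r.
  have := expR_ge1Dx (ln r); rewrite lnK ?posrE // => H.
  by apply: le_trans H; rewrite lerD2l.
have r2 : (1 - e) * r <= 1.
  have := expR_ge1Dx (- ln r); rewrite expRN lnK ?posrE // => H.
  rewrite -ler_pdivlMr // mul1r; apply: le_trans H.
  by rewrite lerD2l lerN2.
have e1 : (1 - e) * (r - 1 - 2 * e) <= 0 by nra.
have r3 : r - 1 - 2 * e <= 0 by nra.
rewrite yE -{2}[x]mul1r -mulrBl normrM (gtr0_norm x0) ler_wpM2r ?(ltW x0) //.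
by rewrite ler_norml; apply/andP; split; lra.
Qed.

Lemma geo_dist_bounds (k e : R) a b X Y : 0 < k -> 0 <= e ->
  eigen_decomp X a -> eigen_decomp Y b -> geo_dist k a b <= e ->
  frobenius (rot_log (b.1 *m a.1^T)) <= Num.sqrt (2 / k) * e /\
  forall i, `|ln (b.2 i i / a.2 i i)| <= e.
Proof.
move=> k0 e0 Ea Eb; rewrite (geo_distE k Ea Eb).
set F := frobenius _; set S := \sum_i _ => gd.
have F0 : 0 <= F by exact: frobenius_ge0.
have S0 : 0 <= S by rewrite sumr_ge0 // => i _; rewrite sqr_ge0.
have T0 : 0 <= k / 2 * F ^+ 2 by rewrite mulr_ge0 ?sqr_ge0 // divr_ge0 // ltW.
have {gd}gd : k / 2 * F ^+ 2 + S <= e ^+ 2.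
  rewrite -[leLHS]sqr_sqrtr ?addr_ge0 //.
  by rewrite ler_pXn2r // nnegrE sqrtr_ge0.
split=> [|i].
  rewrite -(@ler_pXn2r _ 2) ?nnegrE ?mulr_ge0 ?sqrtr_ge0 // exprMn.
  rewrite (@sqr_sqrtr _ (2 / k)) ?divr_ge0 ?(ltW k0) //.
  rewrite [leLHS](_ : _ = 2 / k * (k / 2 * F ^+ 2)); last first.
    by field; rewrite gt_eqF.
  by rewrite ler_wpM2l ?divr_ge0 ?(ltW k0) //; lra.
rewrite -(@ler_pXn2r _ 2) ?nnegrE // real_normK ?num_real //.
apply: le_trans (_ : S <= _); last by lra.
rewrite /S (bigD1 i) //= lerDl sumr_ge0 // => j _; exact: sqr_ge0.
Qed.

(** For [X = U D U'] and [Y = V L V'], the comparison goes through [Z = U L U']: [X - Z] is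
    controlled by the eigenvalues, [Z - Y] by the rotation [M = V U']. *)
Lemma eigen_decomp_entry_dist (k : R) X Y : 0 < k ->
  exists C : R, 0 <= C /\ forall (e : R) a b, 0 <= e <= 2^-1 ->
    eigen_decomp X a -> eigen_decomp Y b -> geo_dist k a b <= e ->
    forall i j, `|X i j - Y i j| <= C * e.
Proof.
move=> k0; pose c := Num.sqrt (2 / k).
have c0 : 0 <= c by exact: sqrtr_ge0.
pose C1 := p%:R * c * expR (p%:R * c).
have C10 : 0 <= C1 by rewrite mulr_ge0 ?expR_ge0 // mulr_ge0.
(* The absolute value ensures a nonnegative constant for arbitrary [X] and [Y]. The two terms bound
   [X - Z] and [Z - Y]. *)
exists (`|2 * \tr X + 2 * p%:R * \tr Y * C1|); split=> //.
move=> e a b e01 Ea Eb gd i j.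
have [e0 e2] := andP e01.
have [Fb lnb] := geo_dist_bounds k0 e0 Ea Eb gd.
case: Ea Eb => [[aa da] pa XE] [[bb db] pb YE].
pose M := b.1 *m a.1^T.
have SM : SO M by apply: SO_mul => //; exact: SO_tr.
have [antiL expL _] := rot_logP SM.
have M1 u v : `|(M - 1%:M) u v| <= C1 * e.
  (* [M - 1] is the difference of the exponentials of [rot_log M] and 0, whose entries are at most
     [c e <= c]. *)
  rewrite -[X in X - _]expL -mxexp0 entryB.
  have -> : C1 * e = p%:R * (c * e) * expR (p%:R * c) by rewrite /C1; ring.
  have ce : c * e <= c by rewrite -[leRHS]mulr1 ler_wpM2l //; lra.
  apply: mxexp_entry_lipschitz => s t.
  - by apply: le_trans ce; apply: le_trans Fb; exact: entry_le_frobenius.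
  - by rewrite mxE normr0.
  - rewrite mxE subr0; apply: le_trans Fb; exact: entry_le_frobenius.
pose Z := a.1 *m b.2 *m a.1^T.
(* [M] intertwines [Y] and [Z], so the difference is linear in the small matrix [M - 1]. *)
have ZY : Z - Y = Y *m (M - 1%:M) - (M - 1%:M) *m Z.
  have YM : Y *m M = M *m Z.
    rewrite YE /M /Z !mulmxA -(mulmxA _ b.1^T) (mulmx1C bb) mulmx1.
    by rewrite -(mulmxA b.1 a.1^T) (mulmx1C aa) mulmx1.
  by rewrite mulmxBr mulmxBl YM mulmx1 mul1mx opprB [RHS]addrC addrA subrK.
have trX : \tr X = \sum_l `|a.2 l l| by rewrite XE conj_diag_trace.
have trY : \tr Y = \sum_l `|b.2 l l| by rewrite YE conj_diag_trace.
have Yle u v : `|Y u v| <= \tr Y.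
  by rewrite trY YE {1}(DiagPosE pb) conj_diag_entry_le.
have Zle u v : `|Z u v| <= \tr Y.
  by rewrite trY /Z {1}(DiagPosE pb) conj_diag_entry_le.
have XZ : `|X i j - Z i j| <= 2 * \tr X * e.
  have -> : X i j - Z i j
      = (a.1 *m diag_mx (\row_l (a.2 l l - b.2 l l)) *m a.1^T) i j.
    rewrite -entryB XE /Z -mulmxBl -mulmxBr {1}(DiagPosE pa) {1}(DiagPosE pb).
    rewrite -raddfB /=; congr ((_ *m diag_mx _ *m _) i j).
    by apply/rowP => l; rewrite !mxE.
  apply: le_trans (conj_diag_entry_le _ _ _ aa) _.
  rewrite trX mulrAC mulr_sumr; apply: ler_sum => l _.
  rewrite distrC; have [[_ a0] [_ b0]] := (pa, pb).
  by rewrite (gtr0_norm (a0 l)) ln_ratio_dist.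
have prod_le A B (x y : R) : (forall u v, `|A u v| <= x) ->
    (forall u v, `|B u v| <= y) -> `|(A *m B) i j| <= p%:R * (x * y).
  move=> Ax By; rewrite mxE; apply: le_trans (ler_norm_sum _ _ _) _.
  apply: (@le_trans _ _ (\sum_(l < p) x * y)).
    by apply: ler_sum => l _; rewrite normrM ler_pM.
  by rewrite sumr_const card_ord -[leLHS]mulr_natl.
have ZYle : `|Z i j - Y i j| <= 2 * (p%:R * (\tr Y * (C1 * e))).
  rewrite -entryB ZY entryB mulr2n mulrDl mul1r.
  apply: le_trans (ler_normB _ _) _; apply: lerD; first exact: prod_le.
  by rewrite [\tr Y * _]mulrC; exact: prod_le.
apply: (@le_trans _ _ ((2 * \tr X + 2 * p%:R * \tr Y * C1) * e)).
  rewrite -(subrK (Z i j) (X i j)) -addrA; apply: le_trans (ler_normD _ _) _.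
  rewrite mulrDl; apply: lerD => //.
  by apply: le_trans ZYle _; rewrite !mulrA.
by rewrite ler_wpM2r // ler_norm.
Qed.

Lemma geo_dist_set_nonempty (k : R) X Y : SymPos X -> SymPos Y ->
  [set geo_dist k a b | a in eigen_decomp X & b in eigen_decomp Y] !=set0.
Proof.
move=> /eigen_decomp_exists[a Ea] /eigen_decomp_exists[b Eb].
by exists (geo_dist k a b); exists a => //; exists b.
Qed.

Lemma sr_dist_ge0 (k : R) X Y : SymPos X -> SymPos Y -> 0 <= sr_dist k X Y.
Proof.
move=> hX hY; apply: lb_le_inf; first exact: geo_dist_set_nonempty.
by move=> _ [a _ [b _ <-]]; exact: geo_dist_ge0.
Qed.

Lemma sr_distxx (k : R) X : SymPos X -> sr_dist k X X = 0.
Proof.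
move=> hX; apply/eqP; rewrite eq_le sr_dist_ge0 // andbT.
have [a Ea] := eigen_decomp_exists hX.
apply: ge_inf; first by exists 0 => _ [c _ [d _ <-]]; exact: geo_dist_ge0.
by exists a => //; exists a => //; exact: geo_distxx Ea.
Qed.

Lemma sr_dist_eq0 (k : R) X Y : 0 < k -> SymPos X -> SymPos Y ->
  sr_dist k X Y = 0 -> X = Y.
Proof.
move=> k0 hX hY dXY; apply/matrixP => i j; apply/eqP; rewrite -subr_eq0.
have [C [C0 HC]] := eigen_decomp_entry_dist X Y k0.
rewrite -normr_le0; apply/ler_addgt0Pl => eps eps0; rewrite addr0.
(* The bound [1/2] is the range of the entry estimate; [C + 1] ensures [C e <= eps] even when
   [C = 0]. *)
pose e := Num.min 2^-1 (eps / (C + 1)).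
have C1 : 0 < C + 1 by rewrite ltr_wpDl.
have e0 : 0 < e by rewrite lt_min invr_gt0 ltr0n divr_gt0.
have [_ [a Ea [b Eb <-]] gd] : exists2 d,
    [set geo_dist k a b | a in eigen_decomp X & b in eigen_decomp Y] d & d < e.
  by apply: inf_lt; [exact: geo_dist_set_nonempty | rewrite -/(sr_dist k X Y) dXY].
apply: le_trans (HC e a b _ Ea Eb (ltW gd) i j) _.
  by rewrite (ltW e0) ge_min lexx.
apply: (@le_trans _ _ (C * (eps / (C + 1)))).
  by rewrite ler_wpM2l // ge_min lexx orbT.
rewrite mulrCA -[leRHS]mulr1 ler_wpM2l ?(ltW eps0) //.
by rewrite ler_pdivrMr // mul1r lerDl.
Qed.

End Separation.

Theorem theorem3p11 (R : realType) (p : nat) (k : R) (hk : 0 < k)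
    (X Y : 'M[R]_p) (hX : SymPos X) (hY : SymPos Y) :
  [/\
      sr_dist k X Y = sr_dist k (invmx X) (invmx Y),
      forall (s : R) (Q : 'M[R]_p), 0 < s -> SO Q ->
        sr_dist k X Y = sr_dist k (s *: (Q *m X *m Q^T)) (s *: (Q *m Y *m Q^T))
    &
      [/\ 0 <= sr_dist k X Y,
          sr_dist k X Y = 0 <-> X = Y
        & sr_dist k X Y = sr_dist k Y X]].
Proof.
split; first exact: sr_dist_inv.
  by move=> s Q s0 SQ; exact: sr_dist_scale_conj.
split; [exact: sr_dist_ge0 | split => [|<-] | exact: sr_dist_sym].
  exact: sr_dist_eq0.
exact: sr_distxx.
Qed.
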